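(* Let $M$ be a nonempty finite metric space with distance function $\rho$, and let $d>0$ be a real number. Then $$A(M,d)\ \geq\ \frac{|M|}{|B_d|}.$$
   Context: For a finite metric space $M$ with distance function $\rho$ and a real number $d$, a subset $C\subseteq M$ is a code of distance $d$ if $\rho(u,v)\geq d$ for all $u\neq v$ in $C$. $A(M,d)$ denotes the largest cardinality of a code of distance $d$ in $M$. For $v\in M$, $B_d(v)=\{u\in M:\rho(u,v)<d\}$ is the open ball of radius $d$ around $v$, and $|B_d|:=\frac{1}{|M|}\sum_{v\in M}|B_d(v)|$ denotes the average size of such a ball. *)

(* Defs.v *)
From HB Require Import structures.
From mathcomp Require Import all_boot all_order all_algebra.
From mathcomp Require Import reals topology.

Set Implicit Arguments.
Unset Strict Implicit.
Unset Printing Implicit Defensive.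

Import Order.TTheory GRing.Theory Num.Theory.
Local Open Scope ring_scope.

#[short(type="finMetricType")]
HB.structure Definition FinMetric (R : numDomainType) :=
  { M of Metric R M & Finite M }.

Section Codes.
Context {R : realType} {M : finMetricType R}.
Implicit Types (d : R) (C : {set M}).

Definition is_code d C : bool :=
  [forall u in C, forall v in C, (u != v) ==> (d <= mdist u v)].

(* The ball v d of the library (see ballEmdist), as a finite set so that it has a
   cardinal; finball_ball below checks the agreement. *)
Definition finball d (v : M) : {set M} := [set u | mdist u v < d].

Lemma finball_ball d (v u : M) : u \in finball d v <-> ball v d u.
Proof. by rewrite inE metric_sym ballEmdist. Qed.

End Codes.

(* A(M, d); the maximum is over a nonempty family, since set0 is a code. *)
Definition max_code_size (R : realType) (M : finMetricType R) (d : R) : nat :=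
  \max_(C : {set M} | is_code d C) #|C|.

Definition avg_ball_size (R : realType) (M : finMetricType R) (d : R) : R :=
  #|M|%:R^-1 * \sum_(v : M) #|finball d v|%:R.

(* Main.v *)
Require Import Defs.
From HB Require Import structures.
From mathcomp Require Import all_boot all_order all_algebra.
From mathcomp Require Import reals topology.
From mathcomp Require Import ring.

(** View the metric space as a graph in which [u] and [v] are adjacent when
    their distance is less than [d].  Codes are the independent sets, and the
    ball around [v] is its closed neighbourhood [N v].  Two inequalities give the
    bound.

    The Caro-Wei inequality ([caro_wei]): some independent set has at least
    [\sum_v 1 / #|N v|] vertices.  The greedy algorithm finds it.  If [v] has
    the smallest closed neighbourhood, then the vertices of [N v] together
    contribute at most [1] to the sum, so one may put [v] in the independent
    set and discard [N v]; the neighbourhoods of the other vertices shrink,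
    which only increases their terms.

    The inequality between harmonic and arithmetic means
    ([sum_inv_ge_card_div_mean]): the sum of the inverses is at least
    [#|M|] divided by the average ball size. *)

Set Implicit Arguments.
Unset Strict Implicit.
Unset Printing Implicit Defensive.

Import Order.TTheory GRing.Theory Num.Theory.
Local Open Scope ring_scope.

(** The tangent line at [a] to the convex function [x |-> x^-1] lies below its
    graph, and the linear terms of these bounds sum to zero around the mean
    [a]. *)
Lemma sum_inv_ge_card_div_mean (R : realFieldType) (T : finType) (b : T -> R)
    (a := #|T|%:R^-1 * \sum_v b v) :
  (forall v, 0 < b v) -> #|T|%:R / a <= \sum_v (b v)^-1.
Proof.
move=> b_gt0.
have [T0|T_gt0] := posnP #|T|.
  by rewrite T0 mul0r sumr_ge0 // => v _; rewrite invr_ge0 ltW.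
have n_gt0 : 0 < #|T|%:R :> R by rewrite ltr0n.
have sum_b : \sum_v b v = #|T|%:R * a by rewrite mulVKf ?gt_eqF.
have a_gt0 : 0 < a.
  case/card_gt0P: T_gt0 => v0 _; rewrite mulr_gt0 ?invr_gt0 //.
  by rewrite (bigD1 v0) //= ltr_pwDl ?sumr_ge0 // => v _; apply: ltW.
clearbody a.
have tangent v : 2 * a^-1 - b v * a^-2 <= (b v)^-1.
  rewrite -subr_ge0.
  have -> : (b v)^-1 - (2 * a^-1 - b v * a^-2) = (b v - a) ^+ 2 / (b v * a ^+ 2).
    by field; rewrite !gt_eqF.
  by rewrite divr_ge0 ?sqr_ge0 ?mulr_ge0 ?sqr_ge0 ?ltW.
apply: le_trans (ler_sum _ (fun v _ => tangent v)).
rewrite sumrB sumr_const -mulr_suml sum_b.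
by rewrite [leRHS](_ : _ = #|T|%:R / a) //; field; rewrite gt_eqF.
Qed.

(** Weights are computed inside a vertex set [S] so that the greedy step, which
    replaces [S] by [S :\: N v], is an induction step. *)
Lemma caro_wei (R : realFieldType) (T : finType) (N : T -> {set T})
    (S : {set T}) :
  (forall v, v \in N v) -> (forall u v, (u \in N v) = (v \in N u)) ->
  exists C : {set T},
    [/\ C \subset S, {in C &, forall u v, u != v -> u \notin N v}
      & \sum_(v in S) #|N v :&: S|%:R^-1 <= #|C|%:R :> R].
Proof.
move=> N_refl N_sym.
have [n] := ubnP #|S|; elim: n S => // n IHn S; rewrite ltnS => S_le_n.
have [->|[w wS]] := set_0Vmem S.
  exists set0; split; first exact: sub0set.
    by move=> u v; rewrite inE.
  by rewrite big_set0.
case: (arg_minnP (fun v => #|N v :&: S|) wS) => v vS v_min.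
have {}vS : v \in S := vS.
set S' := S :\: N v.
have S'_lt : (#|S'| < n)%N.
  apply: leq_trans S_le_n; apply: proper_card.
  apply/properP; split; first exact: subsetDl.
  by exists v => //; rewrite inE N_refl.
have [C [CS' C_indep C_card]] := IHn S' S'_lt.
have far u : u \in C -> u \notin N v.
  by move=> /(subsetP CS'); rewrite inE => /andP[].
exists (v |: C); split.
- by rewrite subUset sub1set vS (subset_trans CS') ?subsetDl.
- move=> x y /setU1P[->|xC] /setU1P[->|yC] //; first by rewrite eqxx.
  + by rewrite N_sym => _; apply: far.
  + by move=> _; apply: far.
  + exact: C_indep.
have cap_gt0 x (A : {set T}) : x \in A -> (0 < #|N x :&: A|)%N.
  by move=> xA; apply/card_gt0P; exists x; rewrite inE N_refl.
have vC : v \notin C by apply/negP => /far; rewrite N_refl.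
rewrite cardsU1 vC natrD (big_setID (N v)) /=.
(* The terms of [S :&: N v] are charged to the new vertex [v], those of [S']
   to [C]. *)
apply: lerD; last first.
  apply: le_trans C_card; apply: ler_sum => u uS'.
  rewrite lef_pV2 ?posrE ?ltr0n ?cap_gt0 //; last by case/setDP: uS'.
  by rewrite ler_nat subset_leq_card // setIS // subsetDl.
apply: (@le_trans _ _ (\sum_(u in S :&: N v) #|N v :&: S|%:R^-1)).
  apply: ler_sum => u /setIP[uS _].
  by rewrite lef_pV2 ?posrE ?ltr0n ?cap_gt0 // ler_nat v_min.
by rewrite sumr_const [S :&: _]setIC -[leLHS]mulr_natl divff // pnatr_eq0 -lt0n cap_gt0.
Qed.

Theorem theorem4 (R : realType) (M : finMetricType R) (d : R)
    (M_nonempty : (0 < #|M|)%N) (d_gt0 : 0 < d) :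
  (max_code_size M d)%:R >= #|M|%:R / avg_ball_size M d.
Proof.
have ball_refl (v : M) : v \in finball d v by rewrite inE mdistxx.
have ball_sym (u v : M) : (u \in finball d v) = (v \in finball d u).
  by rewrite !inE metric_sym.
have [C [_ C_indep C_card]] := caro_wei R [set: M] ball_refl ball_sym.
have C_code : is_code d C.
  apply/forall_inP => u uC; apply/forall_inP => v vC; apply/implyP => uv.
  by have := C_indep u v uC vC uv; rewrite inE -leNgt.
apply: (@le_trans _ _ #|C|%:R); last by rewrite ler_nat; apply: leq_bigmax_cond.
apply: le_trans C_card.
under eq_bigr do rewrite setIT.
rewrite (eq_bigl xpredT) => [|v]; last by rewrite inE.
apply: sum_inv_ge_card_div_mean => v.
by rewrite ltr0n; apply/card_gt0P; exists v.
Qed.
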